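(* Let $0<\lambda<1$, $0<\alpha\le 1$, $D=[-1,1]^2$. Let $x_k=-1+2k/n$ for $k=0,\dots,n$, $x_k'=(x_k+x_{k+1})/2$ and $\Delta_{kl}=[x_k,x_{k+1}]\times[x_l,x_{l+1}]$ for $k,l=0,\dots,n-1$. Among all cubature formulas $$(Tf)(t_1,t_2)=\sum_{k_1=1}^{n}\sum_{k_2=1}^{n}p_{k_1k_2}(t_1,t_2)f(x_{k_1},y_{k_2})+R_{nn}(f;p_{k_1k_2};x_{k_1},y_{k_2};t_1,t_2)$$ with arbitrary coefficients and nodes, the formula $$(Tf)(t_1,t_2)=\sum_{k=0}^{n-1}\sum_{l=0}^{n-1}f(x_k',x_l')\iint_{\Delta_{kl}}\frac{d\tau_1d\tau_2}{((\tau_1-t_1)^2+(\tau_2-t_2)^2)^{\lambda}}+R_{nn}(f),$$ whose error on the class $H_{\alpha\alpha}(D)$ satisfies $$R_{nn}[H_{\alpha\alpha}(D)]\le\frac{1+o(1)}{(1+\alpha)n^{\alpha}}\sup_{(t_1,t_2)\in D}\int_{-1}^1\int_{-1}^1\frac{d\tau_1d\tau_2}{((\tau_1-t_1)^2+(\tau_2-t_2)^2)^{\lambda}}\le\frac{1+o(1)}{(1+\alpha)n^{\alpha}}\int_{-1}^1\int_{-1}^1\frac{d\tau_1d\tau_2}{(\tau_1^2+\tau_2^2)^{\lambda}},\qquad n\to\infty,$$ is optimal with respect to order on the class $H_{\alpha\alpha}(D)$.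
   Context: $(Tf)(t_1,t_2)=\int_{-1}^1\int_{-1}^1\frac{f(\tau_1,\tau_2)\,d\tau_1d\tau_2}{((\tau_1-t_1)^2+(\tau_2-t_2)^2)^{\lambda}}$ for $-1\le t_1,t_2\le 1$. $H_{\alpha\alpha}(D)$ is the class of functions $f$ on $D=[-1,1]^2$ with $|f(x_1,x_2)-f(y_1,y_2)|\le|x_1-y_1|^{\alpha}+|x_2-y_2|^{\alpha}$ for all $(x_1,x_2),(y_1,y_2)\in D$. For a cubature formula with remainder $R_{nn}(f;\cdot;t_1,t_2)$ (exact value minus cubature sum), its error on a class $\Psi$ is $R_{nn}[\Psi]=\sup_{f\in\Psi}\sup_{(t_1,t_2)\in[-1,1]^2}|R_{nn}(f;\cdot;t_1,t_2)|$. $\zeta_{nn}[\Psi]$ is the infimum of this error over all coefficients (functions of $(t_1,t_2)$) and nodes $x_1,\dots,x_n,y_1,\dots,y_n\in[-1,1]$. A formula is optimal with respect to order on $\Psi$ if $R_{nn}[\Psi]\asymp\zeta_{nn}[\Psi]$ as $n\to\infty$, i.e. their ratio stays between two positive finite constants.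
   Formalization: The error bound is proved with 2(1+o(1))/((1+α)n^α) in place of (1+o(1))/((1+α)n^α), because the stated constant is false: f(x)=g(x_1)+g(x_2) with g(s)=dist(s,{x'_k})^α exceeds it. *)

(* Defs.v *)
From HB Require Import structures.
From mathcomp Require Import all_boot all_order all_algebra.
From mathcomp Require Import all_classical all_reals all_analysis.

Set Implicit Arguments.
Unset Strict Implicit.
Unset Printing Implicit Defensive.

Import Order.TTheory GRing.Theory Num.Theory.
Import numFieldNormedType.Exports.

Local Open Scope classical_set_scope.
Local Open Scope ring_scope.

Section Cubature.
Context {R : realType}.
Implicit Types (lambda alpha : R) (f : R * R -> R) (t tau : R * R) (n : nat).

Definition lebesgue2 :=
  (@lebesgue_measure R \x @lebesgue_measure R)%E.

Definition rect (a b c d : R) : set (R * R) := `[a, b] `*` `[c, d].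

Definition square : set (R * R) := rect (-1) 1 (-1) 1.

(* On the diagonal tau = t the value is 0, by the convention 0^-1 = 0; this is
   a null set for the integrals below. *)
Definition riesz lambda t tau : R :=
  (((tau.1 - t.1) ^+ 2 + (tau.2 - t.2) ^+ 2) `^ lambda)^-1.

Definition riesz_op lambda f t : R :=
  \int[lebesgue2]_(tau in square) (f tau * riesz lambda t tau).

(* Functions on the square are represented by functions on the plane, whose
   values outside the square are unconstrained and never used. *)
Definition holder_class alpha : set (R * R -> R) :=
  [set f | forall x y, square x -> square y ->
     `|f x - f y| <= `|x.1 - y.1| `^ alpha + `|x.2 - y.2| `^ alpha].

Definition coefficients n := 'I_n -> 'I_n -> R * R -> R.

Definition remainder lambda n (p : coefficients n) (x y : 'I_n -> R) f t : R :=
  riesz_op lambda f t - \sum_(k < n) \sum_(l < n) p k l t * f (x k, y l).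

(* Extended-real valued: the error of a poorly chosen formula may be +oo. *)
Definition error lambda n (p : coefficients n) (x y : 'I_n -> R)
    (Psi : set (R * R -> R)) : \bar R :=
  ereal_sup [set e | exists f t, [/\ Psi f, square t &
    e = `|remainder lambda p x y f t|%:E]].

Definition zeta lambda n (Psi : set (R * R -> R)) : \bar R :=
  ereal_inf [set e | exists (p : coefficients n) (x y : 'I_n -> R),
    [/\ forall k, x k \in `[-1, 1], forall l, y l \in `[-1, 1] &
        e = error lambda p x y Psi]].

(* The condition 0 < v n < +oo makes the ratio u n / v n meaningful. *)
Definition same_order (u v : nat -> \bar R) : Prop :=
  exists c C : R, [/\ 0 < c, 0 < C & \forall n \near \oo,
    [/\ (0 < v n < +oo)%E, (c%:E * v n <= u n)%E & (u n <= C%:E * v n)%E]].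

Definition optimal_order lambda (p : forall n, coefficients n)
    (x y : forall n, 'I_n -> R) (Psi : set (R * R -> R)) : Prop :=
  same_order (fun n => error lambda (p n) (x n) (y n) Psi)
             (fun n => zeta lambda n Psi).

Definition grid n (k : nat) : R := -1 + 2 * k%:R / n%:R.

Definition midpoint n (k : 'I_n) : R := (grid n k + grid n k.+1) / 2.

Definition cell n (k l : 'I_n) : set (R * R) :=
  rect (grid n k) (grid n k.+1) (grid n l) (grid n l.+1).

(* The error of this formula on [holder_class alpha] is asymptotically bounded by
   2 / ((1 + alpha) n^alpha) times the largest integral of the kernel: on a cell
   of half-side 1/n each of the two terms |x_i - y_i|^alpha of the modulus has
   mean n^(-alpha) / (1 + alpha).  The factor 2, absent from the source, cannot
   be dropped: test f(x) = g(x_1) + g(x_2), where g(s) is the distance from s to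
   the midpoints to the power alpha, with lambda = 1/10 and t = 0. *)
Definition cell_weight lambda n : coefficients n :=
  fun k l t => \int[lebesgue2]_(tau in cell k l) riesz lambda t tau.

End Cubature.

(* Main.v *)
Require Import Defs.
From HB Require Import structures.
From mathcomp Require Import all_boot all_order all_algebra.
From mathcomp Require Import all_classical all_reals all_analysis.
From mathcomp Require Import measurable_realfun.
From mathcomp Require Import ring lra.

Import Order.TTheory GRing.Theory Num.Theory.
Import numFieldNormedType.Exports.

Local Open Scope classical_set_scope.
Local Open Scope ring_scope.

(** The kernel is a power of the distance to [t], integrable because
    [lambda < 1], and every class member is controlled near a midpoint by the
    modulus [|x_1 - y_1|^alpha + |x_2 - y_2|^alpha].

    Upper bound.  The error is the sum over the cells of the integral of
    (f - f(midpoint)) times the kernel, hence at most the integral of modulus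
    times kernel.  If the kernel were constant on the cells, only the mean of
    the modulus over a cell would matter, and this mean is
    2 / ((1 + alpha) n^alpha) ([integral_modulus]).  The kernel is compared with
    its truncation at squared distance [eta].  The truncation varies on a cell
    by a factor at most 1 + 8 / (n eta) ([trunc_riesz_harnack]), and what is cut
    off is at most a power of [eta] times the kernel of a larger exponent
    [lam' < 1], which is still integrable ([riesz_le_trunc]).  This gives
    [remainder_le], and eta = n^(-1/2) makes both corrections vanish in the
    limit, uniformly in [f] and [t].

    The supremum over [t].  The integral of the kernel over the square is
    largest when [t] is the centre ([integral_riesz_center]): along one
    coordinate at a time, moving the window [-1, 1] off the centre of a function
    that decreases with the distance to that centre replaces values taken inside
    the window by smaller values taken outside it ([integral_shift_le]).  So the
    two bounds of the theorem coincide.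

    Lower bound.  Let [f] be the distance of the first coordinate to the nearest
    of the [n] first-coordinate nodes, to the power [alpha] and capped at 1
    ([node_bump]).  It belongs to the class and vanishes at all n^2 nodes, so the
    remainder is the integral of [f] times the kernel, whatever the
    coefficients.  The strips where the distance is below 1 / (2n) cover at most
    half of the square; on the rest [f] is at least (2n)^(-alpha), and the kernel
    at the centre is at least 2^(-lambda).  Hence every formula has error at
    least a constant times n^(-alpha) ([error_node_bump]), the order of the
    upper bound. *)

(** * Integrals on the line *)

Lemma is_derive_powR_primitive {R : realType} (b s : R) : b + 1 != 0 -> 0 < s ->
  is_derive s 1 (fun x : R => x `^ (b + 1) / (b + 1)) (s `^ b).
Proof.
move=> b1 s0.
have dp := is_derive1_powR (b + 1) s0.
rewrite (_ : (fun x : R => x `^ (b + 1) / (b + 1)) =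
   (b + 1)^-1 *: (fun x : R => x `^ (b + 1))).
  apply: is_derive_eq.
  by rewrite addrK /GRing.scale/= mulKf.
by apply/funext => x; rewrite mulrC.
Qed.

Section OneDim.
Context {R : realType}.
Local Notation mu := (@lebesgue_measure R).
Local Open Scope ereal_scope.

(** Translating by [t] maps half-open intervals to intervals of the same length,
    which is enough to identify the image of Lebesgue measure. *)
Lemma integral_translate (D : set R) (f : R -> \bar R) (t : R) :
  measurable D -> measurable_fun D f -> (forall s, 0 <= f s) ->
  \int[mu]_(s in (fun s => s - t)%R @^-1` D) f (s - t)%R =
  \int[mu]_(s in D) f s.
Proof.
move=> mD mf f0.
pose g (s : measurableTypeR R) : measurableTypeR R := (s - t)%R.
have mg : measurable_fun setT g by exact: measurable_funB.
rewrite -(@ge0_integral_pushforward _ _ _ _ R g mg mu D f)//.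
apply: eq_measure_integral => A mA _; apply/esym.
apply: (@lebesgue_measure_unique R (pushforward mu g)) => // _ [[a b]] _ <-.
rewrite [RHS](_ : _ = mu `](a + t)%R, (b + t)%R]%classic); last first.
  rewrite /= /pushforward; congr (mu _); apply/seteqP; split=> s /=;
  by rewrite !in_itv/= /g ltrBrDr lerBlDr.
rewrite !lebesgue_measure_itv/= !lte_fin ltrD2r; case: ifPn => // _.
by rewrite -!EFinD; congr EFin; rewrite opprD addrACA subrr addr0.
Qed.

Lemma integral_reflect (D : set R) (f : R -> \bar R) :
  measurable D -> measurable_fun D f -> (forall s, 0 <= f s) ->
  \int[mu]_(s in -%R @^-1` D) f (- s)%R = \int[mu]_(s in D) f s.
Proof.
move=> mD mf f0.
pose g (s : measurableTypeR R) : measurableTypeR R := (- s)%R.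
have mg : measurable_fun setT g by exact: oppr_measurable.
rewrite -(@ge0_integral_pushforward _ _ _ _ R g mg mu D f)//.
by apply: eq_measure_integral => A mA _; exact: lebesgue_measureN.
Qed.

(** Seen from the centre of [phi], the shifted window is [-1 - t, 1 - t].
    Compared with [-1, 1] it gains the part left of -1 and loses the part
    ]1 - t, 1[, and translation by 2 carries the gained part onto the lost one
    while bringing it closer to 0.  The lost part misses 0, where [phi]
    is unconstrained. *)
Let integral_shift_le_ge0 (phi : R -> \bar R) (t : R) :
  measurable_fun setT phi -> (forall s, 0 <= phi s) ->
  (forall a b : R, (0 < `|a|)%R -> (`|a| <= `|b|)%R -> phi b <= phi a) ->
  (0 <= t <= 1)%R ->
  \int[mu]_(s in `[(-1)%R, 1%R]) phi (s - t)%R <= \int[mu]_(s in `[(-1)%R, 1%R]) phi s.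
Proof.
move=> mphi phi0 dphi /andP[t0 t1].
have mphiS D : measurable_fun D phi by exact: measurable_funS mphi.
rewrite [leLHS]integral_itv_bndoo; last first.
  apply: (@measurable_funS _ _ _ _ setT) => //.
  by apply: measurableT_comp => //; exact: measurable_funB.
rewrite [leRHS]integral_itv_bndoo//.
have -> : \int[mu]_(s in `](-1)%R, 1%R[) phi (s - t)%R =
    \int[mu]_(s in `](-1 - t)%R, (1 - t)%R[) phi s.
  rewrite -(@integral_translate `](-1 - t)%R, (1 - t)%R[%classic phi t)//.
  congr (integral _ _ _); apply/seteqP; split => s /=;
  by rewrite !in_itv/= !ltrD2r.
rewrite (@itv_bndbnd_setU _ _ _ (BRight (-1)%R)); first last.
- by rewrite bnd_simp; lra.
- by rewrite bnd_simp; lra.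
rewrite ge0_integral_setU//; [|exact: mphiS|]; last first.
  apply/disj_setPS => s /= []; rewrite !in_itv/= => /andP[? ?] /andP[? ?]; lra.
rewrite [leRHS](_ : _ = \int[mu]_(s in `](-1)%R, (1 - t)%R[) phi s +
   \int[mu]_(s in `](1 - t)%R, 1%R[) phi s); last first.
  rewrite (@itv_bndbnd_setU _ _ _ (BLeft (1 - t)%R)); first last.
  - by rewrite bnd_simp; lra.
  - by rewrite bnd_simp; lra.
  rewrite ge0_integral_setU//; [|exact: mphiS|]; last first.
    apply/disj_setPS => s /= []; rewrite !in_itv/= => /andP[? ?] /andP[? ?]; lra.
  by rewrite [X in _ + X]integral_itv_bndoo.
rewrite addeC leeD//.
rewrite integral_itv_bndoo//.
have -> : \int[mu]_(s in `](-1 - t)%R, (-1)%R[) phi s =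
    \int[mu]_(s in `](1 - t)%R, 1%R[) phi (s - 2)%R.
  rewrite -(@integral_translate `](-1 - t)%R, (-1)%R[%classic phi 2)//.
  congr (integral _ _ _); apply/seteqP; split => s /=;
  by rewrite !in_itv/=; lra.
apply: ge0_le_integral => //.
- apply: (@measurable_funS _ _ _ _ setT) => //.
  by apply: measurableT_comp => //; exact: measurable_funB.
- exact: mphiS.
- move=> s /=; rewrite in_itv/= => /andP[h1 h2].
by apply: dphi; [rewrite normr_gt0; lra | rewrite ger0_norm ?ltr0_norm; lra].
Qed.

(** The monotonicity hypothesis leaves [phi 0] free: in the application [phi] is a
    slice of the kernel, whose value at the singularity is 0 by convention. *)
Lemma integral_shift_le (phi : R -> \bar R) (t : R) :
  measurable_fun setT phi -> (forall s, 0 <= phi s) ->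
  (forall a b : R, (0 < `|a|)%R -> (`|a| <= `|b|)%R -> phi b <= phi a) ->
  (`|t| <= 1)%R ->
  \int[mu]_(s in `[(-1)%R, 1%R]) phi (s - t)%R <= \int[mu]_(s in `[(-1)%R, 1%R]) phi s.
Proof.
move=> mphi phi0 dphi t1.
have [t0|/ltW t0] := leP 0%R t.
  by apply: integral_shift_le_ge0 => //; rewrite t0 -(ger0_norm t0).
have mphiS D : measurable_fun D phi by exact: measurable_funS mphi.
have itvN : -%R @^-1` `[(-1)%R, 1%R] = `[(-1)%R, 1%R]%classic :> set R.
  by rewrite opp_preimage_itvbndbnd/= opprK.
rewrite -(@integral_reflect _ (fun s => phi (s - t)%R))//; last first.
  apply: (@measurable_funS _ _ _ _ setT) => //.
  by apply: measurableT_comp => //; exact: measurable_funB.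
rewrite -[leRHS]integral_reflect//.
rewrite itvN.
have -> : \int[mu]_(s in `[(-1)%R, 1%R]) phi (- s - t)%R =
    \int[mu]_(s in `[(-1)%R, 1%R]) (phi \o -%R) (s - - t)%R.
  by apply: eq_integral => s _ /=; rewrite opprK opprD.
apply: (@integral_shift_le_ge0 (phi \o -%R)) => //.
- by apply: measurableT_comp.
- by move=> s; exact: phi0.
- by move=> a b a0 ab; apply: dphi; rewrite !normrN.
- by rewrite oppr_ge0 t0 -(ler0_norm t0).
Qed.

(** The fundamental theorem of calculus applies on [h / (n + 1), h], away from the
    possible singularity at 0, and monotone convergence lets [n] grow. *)
Let integral_powR_oc (b h : R) : (-1 < b)%R -> (0 < h)%R ->
  \int[mu]_(s in `]0%R, h]) (s `^ b)%:E = (h `^ (b + 1) / (b + 1))%:E.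
Proof.
move=> b1 h0.
have b10 : (0 < b + 1)%R by lra.
pose e (n : nat) := (h / n.+1%:R)%R.
have e0 n : (0 < e n)%R by rewrite divr_gt0.
have eh n : (e n <= h)%R by rewrite ler_pdivrMr// ler_peMr ?ler1n// ltW.
have ue : \bigcup_n `[e n, h]%classic = `]0%R, h]%classic.
  apply/seteqP; split => [s [n _]/=|s /=]; rewrite !in_itv/= => /andP[s1 s2].
    by rewrite s2 (lt_le_trans (e0 n)).
  exists (Num.truncn (h / s)) => //=.
  rewrite in_itv/= s2 andbT /e ler_pdivrMr// mulrC -ler_pdivrMr//.
  by rewrite ltW// truncnS_gt.
have mp D : measurable_fun D (fun s : R => (s `^ b)%:E).
  apply: (@measurable_funS _ _ _ _ setT) => //; apply/measurable_EFinP.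
  exact: measurable_powR.
have FTC n : \int[mu]_(s in `[e n, h]) (s `^ b)%:E =
    ((h `^ (b + 1) - e n `^ (b + 1)) / (b + 1))%:E.
  have := eh n; rewrite le_eqVlt => /predU1P[<-|ltenh].
    by rewrite set_itv1 integral_set1 subrr mul0r.
  pose F (s : R) := (s `^ (b + 1) / (b + 1))%R.
  have dF (s : R) : (0 < s)%R -> is_derive s 1%R F (s `^ b)%R.
    by apply: is_derive_powR_primitive; rewrite gt_eqF.
  have cF (s : R) : (0 < s)%R -> {for s, continuous F}.
    by move=> s0; apply: differentiable_continuous; apply/derivable1_diffP;
       have := dF _ s0; case.
  rewrite (@continuous_FTC2 R (fun s => s `^ b)%R F)//.
  - by rewrite /F -EFinB mulrBl.
  - apply: continuous_in_subspaceT => s; rewrite inE/= in_itv/= => /andP[s1 _].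
    have s0 : (0 < s)%R by rewrite (lt_le_trans (e0 n)).
    apply: differentiable_continuous; apply/derivable1_diffP.
    by have := is_derive1_powR b s0; case.
  - split.
    + move=> s; rewrite in_itv/= => /andP[s1 _].
      by have := dF s (lt_trans (e0 n) s1); case.
    + by apply: cvg_at_right_filter; exact: cF.
    + by apply: cvg_at_left_filter; exact: cF.
  - move=> s; rewrite in_itv/= => /andP[s1 _].
    have Fs := dF s (lt_trans (e0 n) s1).
    by rewrite derive1E derive_val.
have lim1 : \int[mu]_(s in `[e n, h]) (s `^ b)%:E @[n --> \oo] -->
    \int[mu]_(s in `]0%R, h]) (s `^ b)%:E.
  rewrite -ue; apply: ge0_nondecreasing_set_cvg_integral => //.
  - move=> m n mn; rewrite subsetEset => s /=; rewrite !in_itv/= => /andP[+ ->].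
    rewrite andbT; apply: le_trans; rewrite /e ler_pM2l// lef_pV2 ?posrE//.
    by rewrite ler_nat.
  - by move=> n; exact: mp.
  - by move=> n s _; rewrite lee_fin powR_ge0.
have e_cvg : (e n `^ (b + 1) @[n --> \oo] --> 0)%R.
  apply: ((cvg_at_rightP _ _ _).1 (powR_cvg0 b10) e).
  split=> [n|]; first exact: e0.
  by rewrite -[X in _ --> X](mulr0 h); apply: cvgMr; exact: cvg_harmonic.
have lim2 : \int[mu]_(s in `[e n, h]) (s `^ b)%:E @[n --> \oo] -->
    (h `^ (b + 1) / (b + 1))%:E.
  under eq_fun do rewrite FTC.
  apply: cvg_EFin; first exact: nearW.
  rewrite -[X in _ --> X]/(h `^ (b + 1) / (b + 1))%R -[X in (X / _)%R]subr0.
  by apply: cvgMl; apply: cvgB e_cvg; exact: cvg_cst.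
exact: (cvg_unique _ lim1 lim2).
Qed.

(** Used with a negative exponent for the integrability of the kernel, and with
    [b = alpha] for the exact mean of the modulus on a cell. *)
Lemma integral_powR_itv (b m h : R) : (-1 < b)%R -> (0 < h)%R ->
  \int[mu]_(s in `[(m - h)%R, (m + h)%R]) (`|s - m| `^ b)%:E =
  (2 * h `^ (b + 1) / (b + 1))%:E.
Proof.
move=> b1 h0.
pose g (s : R) := (`|s| `^ b)%:E.
have mg D : measurable_fun D g.
  apply: (@measurable_funS _ _ _ _ setT) => //; apply/measurable_EFinP.
  by apply: (@measurableT_comp _ _ _ _ _ _ (@powR R ^~ b)).
have g0 s : 0 <= g s by rewrite lee_fin powR_ge0.
rewrite (_ : `[(m - h)%R, (m + h)%R]%classic =
    (fun s => s - m)%R @^-1` `[(- h)%R, h]%classic); last first.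
  by apply/seteqP; split=> s /=; rewrite !in_itv/= => /andP[? ?]; lra.
rewrite (@integral_translate _ g)//.
rewrite (@itv_bndbnd_setU _ _ _ (BLeft 0%R)); first last.
- by rewrite bnd_simp ltW.
- by rewrite bnd_simp; lra.
rewrite ge0_integral_setU//; [|exact: mg|]; last first.
  apply/disj_setPS => s /= []; rewrite !in_itv/= => /andP[? ?] /andP[? ?]; lra.
have pos : \int[mu]_(s in `]0%R, h]) g s = (h `^ (b + 1) / (b + 1))%:E.
  rewrite -(integral_powR_oc _ _ b1 h0); apply: eq_integral => s.
  by rewrite inE/= in_itv/= => /andP[s0 _]; rewrite /g gtr0_norm.
rewrite -[X in _ + X]integral_itv_obnd_cbnd// pos.
rewrite -[X in X + _](@integral_reflect _ g)//.
rewrite opp_preimage_itvbndbnd/= oppr0 opprK.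
under eq_integral do rewrite /g normrN.
by rewrite pos -EFinD -mulrDl -mulr2n mulr_natl.
Qed.

End OneDim.

(** * Iterated integrals over rectangles *)

Section Tonelli.
Context {R : realType}.
Local Notation mu := (@lebesgue_measure R).
Local Notation mu2 := (@lebesgue_measure R \x @lebesgue_measure R)%E.
Local Open Scope ereal_scope.
Implicit Types (f : R * R -> \bar R) (A B : set R).

Lemma measurable_integral_slice1 f B :
  measurable B -> measurable_fun setT f -> (forall z, 0 <= f z) ->
  measurable_fun setT (fun x : R => \int[mu]_(y in B) f (x, y)).
Proof.
move=> mB mf f0.
pose g := f \_ (setT `*` B).
rewrite (_ : (fun x => _) = fubini_F mu g).
  apply: measurable_fun_fubini_tonelli_F => //.
    apply/(measurable_restrictT f); first exact: measurableX.
    exact: measurable_funS mf.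
  by move=> z; exact: erestrict_ge0.
apply/funext => x; rewrite /fubini_F [LHS]integral_mkcond; apply: eq_integral => y _.
by rewrite /g !patchE/= in_setX in_setT.
Qed.

Lemma measurable_integral_slice2 f A :
  measurable A -> measurable_fun setT f -> (forall z, 0 <= f z) ->
  measurable_fun setT (fun y : R => \int[mu]_(x in A) f (x, y)).
Proof.
move=> mB mf f0.
pose g := f \_ (A `*` setT).
rewrite (_ : (fun x => _) = fubini_G mu g).
  apply: measurable_fun_fubini_tonelli_G => //.
    apply/(measurable_restrictT f); first exact: measurableX.
    exact: measurable_funS mf.
  by move=> z; exact: erestrict_ge0.
apply/funext => x; rewrite /fubini_G [LHS]integral_mkcond; apply: eq_integral => y _.
by rewrite /g !patchE/= in_setX in_setT andbT.
Qed.

Lemma tonelli_rect f A B :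
  measurable A -> measurable B -> measurable_fun setT f -> (forall z, 0 <= f z) ->
  \int[mu2]_(z in A `*` B) f z = \int[mu]_(x in A) \int[mu]_(y in B) f (x, y) /\
  \int[mu2]_(z in A `*` B) f z = \int[mu]_(y in B) \int[mu]_(x in A) f (x, y).
Proof.
move=> mA mB mf f0.
pose g := f \_ (A `*` B).
have mg : measurable_fun setT g.
  apply/(measurable_restrictT f); first exact: measurableX.
  exact: measurable_funS mf.
have g0 z : 0 <= g z by exact: erestrict_ge0.
split; rewrite [LHS]integral_mkcond.
  rewrite fubini_tonelli1// /fubini_F [RHS]integral_mkcond.
  apply: eq_integral => x _; rewrite [RHS]patchE; case: ifPn => xA.
    rewrite [RHS]integral_mkcond; apply: eq_integral => y _.
    by rewrite !patchE/= in_setX xA.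
  by rewrite integral0_eq// => y _; rewrite patchE in_setX/= (negbTE xA).
rewrite fubini_tonelli2// /fubini_G [RHS]integral_mkcond.
apply: eq_integral => y _; rewrite [RHS]patchE; case: ifPn => yB.
  rewrite [RHS]integral_mkcond; apply: eq_integral => x _.
  by rewrite !patchE/= in_setX yB andbT.
by rewrite integral0_eq// => x _; rewrite patchE in_setX/= (negbTE yB) andbF.
Qed.

End Tonelli.

(** * The kernel and its integral over the square *)

Section Kernel.
Context {R : realType}.
Local Notation mu := (@lebesgue_measure R).
Local Notation mu2 := (@lebesgue_measure R \x @lebesgue_measure R)%E.

Definition sqdist (t z : R * R) : R := (z.1 - t.1) ^+ 2 + (z.2 - t.2) ^+ 2.

Lemma sqdist_ge0 t z : 0 <= sqdist t z.
Proof. by rewrite addr_ge0 ?sqr_ge0. Qed.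

Lemma sqdist_eq0 t z : (sqdist t z == 0) = (z == t).
Proof.
rewrite paddr_eq0 ?sqr_ge0// !sqrf_eq0 !subr_eq0.
by case: t z => [? ?] [? ?].
Qed.

Lemma measurable_sqdist t : measurable_fun setT (sqdist t).
Proof.
by apply: measurable_funD; apply: measurable_funX; apply: measurable_funB.
Qed.

(** The negative exponent follows the convention of the kernel at [z = t], since
    0 to a nonzero power is 0. *)
Lemma rieszE l t z : riesz l t z = sqdist t z `^ (- l).
Proof. by rewrite powRN. Qed.

Lemma riesz_ge0 (l : R) t z : 0 <= riesz l t z.
Proof. by rewrite rieszE powR_ge0. Qed.

Lemma measurable_riesz l t : measurable_fun setT (@riesz R l t).
Proof.
rewrite (_ : riesz l t = @powR R ^~ (- l) \o sqdist t).
  by apply: measurableT_comp; [exact: measurable_powR|exact: measurable_sqdist].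
by apply/funext => z; rewrite rieszE.
Qed.

Lemma measurable_rect (a b c d : R) :
  measurable (rect a b c d : set (measurableTypeR R * measurableTypeR R)).
Proof. exact: measurableX. Qed.

Lemma measurable_square :
  measurable (@square R : set (measurableTypeR R * measurableTypeR R)).
Proof. exact: measurable_rect. Qed.

Lemma measure_rect (a b c d : R) : a <= b -> c <= d ->
  mu2 (rect a b c d) = ((b - a) * (d - c))%:E.
Proof.
move=> ab cd; rewrite /rect product_measure1E//.
rewrite /= !lebesgue_measure_itv/= !lte_fin EFinM; congr (_ * _)%E.
- by case: ltgtP ab => // -> _; rewrite subrr.
- by case: ltgtP cd => // -> _; rewrite subrr.
Qed.

Lemma powRN_antimono (l a b : R) : 0 <= l -> 0 < a -> a <= b ->
  b `^ (- l) <= a `^ (- l).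
Proof.
move=> l0 a0 ab; rewrite !powRN lef_pV2 ?posrE ?powR_gt0 ?(lt_le_trans a0)//.
by apply: ge0_ler_powR; rewrite ?nnegrE// ltW// (lt_le_trans a0).
Qed.

Lemma riesz_antimono1 (l t1 t2 a b y : R) : 0 <= l -> 0 < `|a - t1| ->
  `|a - t1| <= `|b - t1| -> riesz l (t1, t2) (b, y) <= riesz l (t1, t2) (a, y).
Proof.
move=> l0 a0 ab; rewrite !rieszE; apply: powRN_antimono => //.
  by rewrite /sqdist/= ltr_pwDl ?sqr_ge0// exprn_even_gt0//= -normr_gt0.
rewrite /sqdist/= lerD2r -(real_normK (num_real (a - t1))).
by rewrite -(real_normK (num_real (b - t1))) lerXn2r// nnegrE.
Qed.

Lemma riesz_swap (l : R) (t z : R * R) : riesz l (t.2, t.1) (z.2, z.1) = riesz l t z.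
Proof. by rewrite !rieszE /sqdist/= addrC. Qed.

Lemma riesz_antimono2 (l t1 t2 a b x : R) : 0 <= l -> 0 < `|a - t2| ->
  `|a - t2| <= `|b - t2| -> riesz l (t1, t2) (x, b) <= riesz l (t1, t2) (x, a).
Proof.
by rewrite -(riesz_swap _ _ (x, b)) -(riesz_swap _ _ (x, a)); exact: riesz_antimono1.
Qed.

(** The two coordinates of [t] are moved to 0 one after the other; Tonelli's theorem
    exchanges the order of integration in between. *)
Lemma integral_riesz_center l t : 0 < l -> square t ->
  (\int[mu2]_(z in square) (riesz l t z)%:E <=
   \int[mu2]_(z in square) (riesz l (0%R, 0%R) z)%:E)%E.
Proof.
case: t => t1 t2 l0 [/=]; rewrite !in_itv/= -!ler_norml => t1_le1 t2_le1.
pose k (s z : R * R) := (riesz l s z)%:E.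
have mk s : measurable_fun setT (k s).
  by apply/measurable_EFinP; exact: measurable_riesz.
have k0 s z : (0 <= k s z)%E by rewrite lee_fin riesz_ge0.
have mk1 s y : measurable_fun setT (fun x : R => k s (x, y)).
  by apply: (@measurableT_comp _ _ _ _ _ _ (k s)); first exact: mk.
have mk2 s x : measurable_fun setT (fun y : R => k s (x, y)).
  by apply: (@measurableT_comp _ _ _ _ _ _ (k s)); first exact: mk.
rewrite /square /rect.
have ton s := @tonelli_rect _ (k s) `[-1, 1]%classic `[-1, 1]%classic
  (measurable_itv _) (measurable_itv _) (mk s) (k0 s).
rewrite (ton (t1, t2)).2 (ton (0, 0)).1.
apply: (@le_trans _ _
    (\int[mu]_(y in `[(-1)%R, 1%R]) \int[mu]_(x in `[(-1)%R, 1%R]) k (0%R, t2) (x, y))%E).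
  apply: ge0_le_integral => //.
  - by move=> y _; apply: integral_ge0.
  - apply: (measurable_funS measurableT) => //.
    exact: (measurable_integral_slice2 (k (t1, t2))).
  - apply: (measurable_funS measurableT) => //.
    exact: (measurable_integral_slice2 (k (0, t2))).
  - move=> y _.
    have -> : (\int[mu]_(x in `[(-1)%R, 1%R]) k (t1, t2) (x, y) =
        \int[mu]_(x in `[(-1)%R, 1%R]) k (0%R, t2) ((x - t1)%R, y))%E.
      by apply: eq_integral => x _; rewrite /k !rieszE /sqdist/= subr0.
    apply: (@integral_shift_le R (fun x => k (0, t2) (x, y))) => // a b a0 ab.
    by rewrite lee_fin riesz_antimono1 ?subr0// ltW.
rewrite -(ton (0, t2)).2 (ton (0, t2)).1; apply: ge0_le_integral => //.
- by move=> y _; apply: integral_ge0.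
- apply: (measurable_funS measurableT) => //.
  exact: (measurable_integral_slice1 (k (0, t2))).
- apply: (measurable_funS measurableT) => //.
  exact: (measurable_integral_slice1 (k (0, 0))).
- move=> x _.
  have -> : (\int[mu]_(y in `[(-1)%R, 1%R]) k (0%R, t2) (x, y) =
      \int[mu]_(y in `[(-1)%R, 1%R]) k (0%R, 0%R) (x, (y - t2)%R))%E.
    by apply: eq_integral => y _; rewrite /k !rieszE /sqdist/= !subr0.
  apply: (@integral_shift_le R (fun y => k (0, 0) (x, y))) => // a b a0 ab.
  by rewrite lee_fin riesz_antimono2 ?subr0// ltW.
Qed.

(** Serves for the coordinate axes, where the kernel is not dominated by a product,
    and for the grid lines, which neighbouring closed cells share. *)
Lemma cross_null (E : set R) : measurable E -> mu E = 0%E ->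
  measurable (E `*` setT `|` setT `*` E :
    set (measurableTypeR R * measurableTypeR R)) /\
  mu2 (E `*` setT `|` setT `*` E) = 0%E.
Proof.
move=> mE E0; split; first by apply: measurableU; apply: measurableX.
apply/eqP; rewrite eq_le measure_ge0 andbT.
have -> : 0%E = (mu2 (E `*` setT) + mu2 (setT `*` E))%E.
  rewrite product_measure1E//= product_measure1E//= [X in (X * _)%E]E0.
  by rewrite [X in (_ + _ * X)%E]E0 mul0e mule0 adde0.
by apply: measureU2; exact: measurableX.
Qed.

(** Off the axes x^2 + y^2 >= |x| |y|, so the kernel is at most
    |x|^(-l) |y|^(-l), whose integral factors into two convergent ones. *)
Lemma integral_riesz_lty l : 0 < l < 1 ->
  (\int[mu2]_(z in square) (riesz l (0%R, 0%R) z)%:E < +oo)%E.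
Proof.
move=> /andP[l0 l1].
pose N : set (R * R) := [set 0] `*` setT `|` setT `*` [set 0].
have [mN N0] := cross_null [set 0] (measurable_set1 _) (lebesgue_measure_set1 _).
have int1 : (\int[mu]_(s in `[(-1)%R, 1%R]) (`|s| `^ (- l))%:E =
    (2 / (1 - l))%:E)%E.
  have := @integral_powR_itv R (- l) 0 1.
  rewrite sub0r add0r ltrN2 => /(_ l1 ltr01).
  rewrite powR1 mulr1 (addrC (- l)) => <-.
  by apply: eq_integral => s _; rewrite subr0.
pose g (z : R * R) := ((`|z.1| `^ (- l)) * (`|z.2| `^ (- l)))%:E.
have mg : measurable_fun setT g.
  apply/measurable_EFinP; apply: measurable_funM.
    apply: (@measurableT_comp _ _ _ _ _ _ (@powR R ^~ (- l))) => //.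
    exact: measurableT_comp.
  apply: (@measurableT_comp _ _ _ _ _ _ (@powR R ^~ (- l))) => //.
  exact: measurableT_comp.
have g0 z : (0 <= g z)%E by rewrite lee_fin mulr_ge0// powR_ge0.
apply: (@le_lt_trans _ _ (\int[mu2]_(z in square) g z)%E).
  apply: ae_ge0_le_integral => //.
  - exact: measurable_square.
  - by move=> z _; rewrite lee_fin riesz_ge0.
  - apply: (measurable_funS measurableT) => //; apply/measurable_EFinP.
    exact: measurable_riesz.
  - exact: measurable_funS mg.
  exists N; split; [exact: mN|exact: N0|].
  move=> [x y] /= H; rewrite /N/=.
  have [->|x0] := eqVneq x 0; first by left.
  have [->|y0] := eqVneq y 0; first by right.
  exfalso; apply: H => _; rewrite lee_fin rieszE /sqdist/= !subr0.
  rewrite -powRM//; apply: powRN_antimono; first exact: ltW.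
    by rewrite mulr_gt0// normr_gt0.
  rewrite -(real_normK (num_real x)) -(real_normK (num_real y)).
  by rewrite -subr_ge0; have := sqr_ge0 (`|x| - `|y|); have := normr_ge0 x;
    have := normr_ge0 y; nra.
rewrite /square /rect (tonelli_rect _ _ _ _ _ mg g0).1//.
have mp (D : set R) : measurable_fun D (fun s : R => (`|s| `^ (- l))%:E).
  apply: (@measurable_funS _ _ _ _ setT) => //; apply/measurable_EFinP.
  exact: (@measurableT_comp _ _ _ _ _ _ (@powR R ^~ (- l))).
have slice (x : R) : (\int[mu]_(y in `[(-1)%R, 1%R]) g (x, y) =
    (2 / (1 - l))%:E * (`|x| `^ (- l))%:E)%E.
  by rewrite muleC -int1 -ge0_integralZl//; exact: mp.
under eq_integral do rewrite slice.
rewrite ge0_integralZl//; last 2 first.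
- exact: mp.
- by rewrite lee_fin divr_ge0//; lra.
by rewrite int1 ltry.
Qed.

End Kernel.

(** * The grid of cells *)

Section Grid.
Context {R : realType} {n : nat}.
Context (n_gt0 : (0 < n)%N).
Local Notation mu := (@lebesgue_measure R).
Local Notation mu2 := (@lebesgue_measure R \x @lebesgue_measure R)%E.
Local Notation g := (@grid R n).
Local Notation m := (@midpoint R n).

Let nR_gt0 : 0 < n%:R :> R. Proof. by rewrite ltr0n. Qed.

Lemma gridE (k : 'I_n) : g k = m k - n%:R^-1.
Proof. by rewrite /midpoint /grid -natr1; field; rewrite gt_eqF. Qed.

Lemma gridSE (k : 'I_n) : g k.+1 = m k + n%:R^-1.
Proof. by rewrite /midpoint /grid -natr1; field; rewrite gt_eqF. Qed.

Lemma cellE (k l : 'I_n) : cell k l = rect (m k - n%:R^-1) (m k + n%:R^-1)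
  (m l - n%:R^-1) (m l + n%:R^-1).
Proof. by rewrite /cell !gridE !gridSE. Qed.

Lemma grid_itv k : (k <= n)%N -> -1 <= g k <= 1.
Proof.
move=> kn; rewrite /grid -lerBlDl subrr -lerBrDl.
rewrite divr_ge0 ?mulr_ge0//= ler_pdivrMr//.
have : k%:R <= n%:R :> R by rewrite ler_nat.
lra.
Qed.

Lemma cell_square (k l : 'I_n) : cell k l `<=` @square R.
Proof.
move=> z [/=]; rewrite !in_itv/= => /andP[a1 a2] /andP[b1 b2].
have /andP[k1 _] := grid_itv _ (ltnW (ltn_ord k)).
have /andP[l1 _] := grid_itv _ (ltnW (ltn_ord l)).
have /andP[_ k2] := grid_itv _ (ltn_ord k).
have /andP[_ l2] := grid_itv _ (ltn_ord l).
by split; rewrite /= in_itv/=; apply/andP; split; lra.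
Qed.

Lemma cell_midpoint (k l : 'I_n) : cell k l (m k, m l).
Proof.
have := invr_gt0 (n%:R : R); rewrite nR_gt0 => h.
by rewrite cellE; split; rewrite /= in_itv/=; apply/andP; split; lra.
Qed.

Lemma midpoint_itv (k : 'I_n) : m k \in `[-1, 1].
Proof. by have [] := cell_square _ _ _ (cell_midpoint k k). Qed.

Lemma measurable_cell (k l : 'I_n) :
  measurable (@cell R n k l : set (measurableTypeR R * measurableTypeR R)).
Proof. exact: measurable_rect. Qed.

Lemma cell_dist (k l : 'I_n) z : cell k l z ->
  `|z.1 - m k| <= n%:R^-1 /\ `|z.2 - m l| <= n%:R^-1.
Proof.
rewrite cellE => -[/=]; rewrite !in_itv/= => h1 h2.
by rewrite !ler_distl.
Qed.

Lemma grid_leE k (s : R) : (g k <= s) = (k%:R <= (s + 1) * n%:R / 2).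
Proof. by rewrite /grid addrC -lerBrDr opprK ler_pdivlMr// ler_pdivrMr// mulrC. Qed.

Lemma le_gridE k (s : R) : (s <= g k) = ((s + 1) * n%:R / 2 <= k%:R).
Proof. by rewrite /grid addrC -lerBlDr opprK ler_pdivrMr// ler_pdivlMr// [2 * _]mulrC. Qed.

(** Off the grid points the index of an interval containing [s] is determined by
    [s], which makes the cells without their boundaries disjoint. *)
Lemma grid_interval_index (k : 'I_n) (s : R) : ~ range g s -> g k <= s <= g k.+1 ->
  Num.truncn ((s + 1) * n%:R / 2) = k.
Proof.
move=> sE /andP[ks sk]; apply: truncn_def; rewrite -grid_leE ks/=.
rewrite ltNge -grid_leE; apply/negP => ks1.
by apply: sE; exists k.+1 => //; apply/eqP; rewrite eq_le ks1.
Qed.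

Lemma grid_interval_cover (s : R) : ~ range g s -> s \in `[-1, 1] ->
  exists k : 'I_n, g k <= s <= g k.+1.
Proof.
move=> sE; rewrite in_itv/= => /andP[s1 s2].
pose x : R := (s + 1) * n%:R / 2.
have x0 : 0 <= x by rewrite divr_ge0// mulr_ge0//; lra.
have /andP[kx xk] := truncn_itv x0.
have gn : g n = 1 by rewrite /grid mulfK ?gt_eqF//; lra.
have kn : (Num.truncn x < n)%N.
  rewrite ltnNge; apply/negP => nk; apply: sE; exists n => //.
  apply/eqP; rewrite eq_le grid_leE -/x (le_trans _ kx) ?ler_nat//= gn.
  by rewrite s2.
by exists (Ordinal kn); rewrite grid_leE le_gridE kx ltW.
Qed.

(** The closed cells overlap, but only on grid lines; these form a null set, and
    off it the cells partition the square. *)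
Lemma integral_square_cells (f : R * R -> R) :
  mu2.-integrable square (EFin \o f) ->
  \int[mu2]_(z in square) f z =
  \sum_(k < n) \sum_(l < n) \int[mu2]_(z in cell k l) f z.
Proof.
move=> intf.
have cE : countable (range g) by exact: card_image_le.
have mE : measurable (range g) by apply: countable_measurable cE => t; exact: measurable_set1.
have [mN N0] := cross_null (range g) mE
  (countable_lebesgue_measure0 cE).
set N := (X in measurable X) in mN N0.
have mf : measurable_fun square (EFin \o f) by exact: measurable_int intf.
have intc (k l : 'I_n) : mu2.-integrable (cell k l) (EFin \o f).
  exact: (integrableS measurable_square (measurable_cell k l)
    (cell_square k l) intf).
rewrite pair_bigA/= /Rintegral sum_fine/=; last first.
  by move=> [k l] _; apply: integrable_fin_num (intc k l); exact: measurable_cell.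
congr fine.
pose O (p : 'I_n * 'I_n) := cell p.1 p.2 `\` N.
have mO p : measurable (O p) by apply: measurableD => //; exact: measurable_cell.
have -> : (\sum_(p : 'I_n * 'I_n) \int[mu2]_(z in cell p.1 p.2) (f z)%:E =
    \sum_(p : 'I_n * 'I_n) \int[mu2]_(z in O p) (f z)%:E)%E.
  apply: eq_bigr => p _; rewrite (negligible_integral mN)//.
    exact: measurable_cell.
have offE z : ~ N z -> ~ range g z.1 /\ ~ range g z.2.
  by move=> Nz; split=> gz; apply: Nz; [left|right]; split.
have UO : square `\` N = \big[setU/set0]_(p <- enum {: 'I_n * 'I_n}) O p.
  rewrite -bigcup_seq; apply/seteqP; split => [z [[z1 z2] Nz]|z [p _ [pz Nz]]].
    have [z1E z2E] := offE _ Nz.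
    have [k kz] := grid_interval_cover _ z1E z1.
    have [l lz] := grid_interval_cover _ z2E z2.
    by exists (k, l); [rewrite /= mem_enum|split => //; split; rewrite /= in_itv].
  by split => //; exact: cell_square pz.
rewrite (negligible_integral mN)//; last exact: measurable_square.
rewrite UO integral_bigsetU_EFin//.
- by rewrite big_enum.
- exact: enum_uniq.
- move=> [k l] [k' l'] _ _ [z [[[/=]]]].
  rewrite !in_itv/= => k1 l1 Nz [[/=]]; rewrite !in_itv/= => k2 l2 _.
  have [z1E z2E] := offE _ Nz.
  congr (_, _); apply: val_inj => /=.
    by rewrite -(grid_interval_index _ _ z1E k1) -(grid_interval_index _ _ z1E k2).
  by rewrite -(grid_interval_index _ _ z2E l1) -(grid_interval_index _ _ z2E l2).
- rewrite -UO; apply: measurable_funS mf; last exact: subDsetl.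
  exact: measurable_square.
Qed.

End Grid.

(** * The Hoelder class: measurability and integrability *)

Section Holder.
Context {R : realType}.
Local Notation mu := (@lebesgue_measure R).
Local Notation mu2 := (@lebesgue_measure R \x @lebesgue_measure R)%E.
Local Notation T2 := (measurableTypeR R * measurableTypeR R)%type.

Definition modulus (alpha : R) (y x : R * R) : R :=
  `|x.1 - y.1| `^ alpha + `|x.2 - y.2| `^ alpha.

Lemma modulus_ge0 alpha y x : 0 <= modulus alpha y x.
Proof. by rewrite addr_ge0 ?powR_ge0. Qed.

Lemma modulus_le alpha (h : R) y x : 0 <= alpha -> 0 <= h ->
  `|x.1 - y.1| <= h -> `|x.2 - y.2| <= h -> modulus alpha y x <= 2 * h `^ alpha.
Proof.
move=> a0 h0 h1 h2; rewrite mulr_natl mulr2n lerD//.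
- by apply: ge0_ler_powR; rewrite ?nnegrE.
- by apply: ge0_ler_powR; rewrite ?nnegrE.
Qed.

Lemma measurable_modulus alpha y :
  measurable_fun [set: T2] (modulus alpha y).
Proof.
by apply: measurable_funD; apply: (@measurableT_comp _ _ _ _ _ _ (@powR R ^~ alpha)) => //;
  apply: measurableT_comp => //; apply: measurable_funB.
Qed.

Lemma rat_dense_itv (x e : R) : x \in `[-1, 1] -> 0 < e ->
  exists2 q : rat, (ratr q : R) \in `[-1, 1] & `|x - ratr q| < e.
Proof.
rewrite in_itv/= => /andP[x1 x2] e0.
have : Num.max (-1) (x - e) < Num.min 1 (x + e).
  by rewrite gt_max !lt_min; apply/andP; split; apply/andP; split; lra.
move=> /rat_in_itvoo[q]; rewrite in_itv/= gt_max lt_min.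
move=> /andP[/andP[q1 q2] /andP[q3 q4]]; exists q.
  by rewrite in_itv/=; apply/andP; split; lra.
by rewrite ltr_norml; apply/andP; split; lra.
Qed.

(** On the square [f] is the infimum of [f q + modulus alpha q z] over rational
    points [q] of the square, so each sublevel set of [f] is a countable union of
    sublevel sets of measurable functions. *)
Lemma measurable_holder alpha (f : R * R -> R) : 0 < alpha ->
  holder_class alpha f -> measurable_fun (square : set T2) f.
Proof.
move=> alpha0 Hf mS.
apply: (measurability _ (RGenInftyO.measurableE R)) => //.
move=> _ [_ [a ->] <-].
pose Q (q : rat * rat) : R * R := (ratr q.1, ratr q.2).
pose F (q : rat * rat) : set T2 :=
  [set z | [/\ square (Q q), square z & f (Q q) + modulus alpha (Q q) z < a]].
rewrite (_ : _ `&` _ = \bigcup_q F q).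
  apply: countable_bigcupT_measurable => // q.
  have [Sq|nSq] := pselect (square (Q q)); last first.
    by rewrite (_ : F q = set0)//; apply/seteqP; split => z; [case|].
  rewrite (_ : F q = square `&`
      (fun z => f (Q q) + modulus alpha (Q q) z) @^-1` `]-oo, a[%classic); last first.
    apply/seteqP; split => z /=; rewrite /F/= in_itv/=; first by move=> [_ ? ?].
    by move=> [? ?]; split.
  apply: measurable_funD => //.
  by apply: (measurable_funS measurableT) => //; exact: measurable_modulus.
apply/seteqP; split => z /=; rewrite in_itv/=; last first.
  move=> [q _ [Sq Sz fq]]; split => //; apply: le_lt_trans fq.
  by rewrite -lerBlDl (le_trans (ler_norm _))// Hf.
move=> [Sz fza].
(* f q may exceed f z by the modulus, so the modulus counts twice in
   f q + modulus < a; it is at most 2 e, and 4 e < a - f z. *)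
pose e := (a - f z) / 8.
have e0 : 0 < e by rewrite /e; lra.
pose d := e `^ alpha^-1.
have d0 : 0 < d by rewrite powR_gt0.
have dE : d `^ alpha = e.
  by rewrite /d -powRrM mulVf ?gt_eqF// powRr1// ltW.
have [z1 z2] := Sz.
have [q1 Sq1 zq1] := rat_dense_itv _ _ z1 d0.
have [q2 Sq2 zq2] := rat_dense_itv _ _ z2 d0.
have Sq : square (Q (q1, q2)) by [].
exists (q1, q2) => //; split => //.
have mle : modulus alpha (Q (q1, q2)) z <= 2 * e.
  by rewrite -dE; apply: modulus_le; rewrite ?ltW.
have : f (Q (q1, q2)) - f z <= modulus alpha (Q (q1, q2)) z.
  by rewrite (le_trans _ (Hf _ _ Sz Sq))// -normrN opprB ler_norm.
by move: mle; rewrite /e; lra.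
Qed.

Lemma bounded_holder alpha (f : R * R -> R) : 0 <= alpha ->
  holder_class alpha f -> [bounded f z | z in (square : set T2)].
Proof.
move=> alpha0 Hf.
have S0 : square (0 : R * R).
  by split; rewrite /= in_itv/=; apply/andP; split; lra.
exists (`|f 0| + 2); split; first exact: num_real.
move=> M /ltW hM z Sz; apply: le_trans hM.
rewrite -lerBlDl (le_trans (lerB_dist _ _))// (le_trans (Hf _ _ Sz S0))//.
rewrite (le_trans (modulus_le alpha 1 _ _ _ _ _ _))// ?powR1 ?mulr1//=.
- by case: Sz => + _; rewrite /= in_itv/= -ler_norml subr0.
- by case: Sz => _; rewrite /= in_itv/= -ler_norml subr0.
Qed.

Lemma integrable_riesz l t : 0 < l < 1 -> square t ->
  mu2.-integrable square (EFin \o riesz l t).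
Proof.
move=> /[dup] l01 /andP[l0 _] St; apply/integrableP; split.
  apply: (measurable_funS measurableT) => //; apply/measurable_EFinP.
  exact: measurable_riesz.
under eq_integral do rewrite /= ger0_norm ?riesz_ge0//.
exact: le_lt_trans (integral_riesz_center l t l0 St) (integral_riesz_lty l l01).
Qed.

Lemma integrable_holder_riesz l t alpha f : 0 < l < 1 -> square t -> 0 < alpha ->
  holder_class alpha f ->
  mu2.-integrable square (EFin \o (fun z => f z * riesz l t z)).
Proof.
move=> l01 St alpha0 Hf.
have -> : EFin \o (fun z => f z * riesz l t z) =
    ((EFin \o f) \* (EFin \o riesz l t))%E.
  by apply/funext => z; rewrite /= EFinM.
apply: integrableMr.
- exact: measurable_square.
- exact: measurable_holder Hf.
- by apply: bounded_holder Hf; exact: ltW.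
- exact: integrable_riesz.
Qed.

Lemma Rintegral_riesz_center l t : 0 < l < 1 -> square t ->
  \int[mu2]_(z in square) riesz l t z <= \int[mu2]_(z in square) riesz l (0, 0) z.
Proof.
move=> /[dup] l01 /andP[l0 _] St; rewrite /Rintegral fine_le//.
- apply: integrable_fin_num; first exact: measurable_square.
  exact: integrable_riesz.
- apply: integrable_fin_num; first exact: measurable_square.
  apply: integrable_riesz => //.
  by split; rewrite /= in_itv/=; apply/andP; split; lra.
- exact: integral_riesz_center.
Qed.
End Holder.

(** * Truncation of the kernel *)

Section Truncation.
Context {R : realType}.
Implicit Types (t z : R * R).

Definition trunc_riesz (l eta : R) t z : R := Num.max (sqdist t z) eta `^ (- l).

(** Where the truncation is active, sqdist^(-l) = sqdist^(l' - l) sqdist^(-l') and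
    sqdist < eta. *)
Lemma riesz_le_trunc l l' eta t z : 0 < l -> l < l' -> 0 < eta ->
  riesz l t z <= trunc_riesz l eta t z + eta `^ (l' - l) * riesz l' t z.
Proof.
move=> l0 ll' eta0; rewrite !rieszE /trunc_riesz.
have [d_eta|eta_d] := leP eta (sqdist t z).
  by rewrite lerDl mulr_ge0// powR_ge0.
rewrite -[leLHS]add0r; apply: lerD; first exact: powR_ge0.
have [->|d0] := eqVneq (sqdist t z) 0.
  have l'0 : 0 < l' by lra.
  by rewrite !powR0 ?oppr_eq0 ?gt_eqF// mulr0.
have dgt0 : 0 < sqdist t z by rewrite lt_neqAle eq_sym d0 sqdist_ge0.
rewrite [in leLHS](_ : - l = (l' - l) + - l'); last by lra.
rewrite powRD; last by rewrite d0 implybT.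
rewrite ler_wpM2r ?powR_ge0//.
by apply: ge0_ler_powR; rewrite ?nnegrE ?subr_ge0 ?ltW.
Qed.

Lemma trunc_le_riesz l eta t z : 0 <= l -> z != t ->
  trunc_riesz l eta t z <= riesz l t z.
Proof.
move=> l0 zt; rewrite rieszE; apply: powRN_antimono => //.
  by rewrite lt_neqAle eq_sym sqdist_eq0 zt sqdist_ge0.
by rewrite le_max lexx.
Qed.

(** For coordinates in [-1, 1] the difference of two squares
    (b - a)^2 - (c - a)^2 = (b - c) (b - a + c - a) is at most 4 |b - c|. *)
Lemma sqdist_lip t z w (h : R) : square t -> square z -> square w ->
  `|z.1 - w.1| <= h -> `|z.2 - w.2| <= h ->
  sqdist t z <= sqdist t w + 8 * h.
Proof.
case: t z w => [t1 t2] [z1 z2] [w1 w2].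
rewrite /square/rect/= !in_itv/= => -[t1I t2I] [z1I z2I] [w1I w2I] h1 h2.
have key (a b c : R) : -1 <= a <= 1 -> -1 <= b <= 1 -> -1 <= c <= 1 ->
    `|b - c| <= h -> (b - a) ^+ 2 <= (c - a) ^+ 2 + 4 * h.
  move=> /andP[? ?] /andP[? ?] /andP[? ?] bch.
  rewrite -lerBlDl subr_sqr.
  rewrite (le_trans (ler_norm _))// normrM mulrC ler_pM//.
    by rewrite ler_norml; apply/andP; split; lra.
  by rewrite (_ : b - a - (c - a) = b - c)//; ring.
have k1 := key _ _ _ t1I z1I w1I h1; have k2 := key _ _ _ t2I z2I w2I h2.
by rewrite /sqdist/=; lra.
Qed.

(** A multiplicative comparison: the truncated squared distance is at least [eta],
    so an additive change of [8 * h] is a change by a factor [1 + 8 * h / eta],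
    and raising this factor to the power [l <= 1] does not increase it. *)
Lemma trunc_riesz_harnack l eta t z w (h : R) : 0 <= l <= 1 -> 0 < eta ->
  square t -> square z -> square w ->
  `|z.1 - w.1| <= h -> `|z.2 - w.2| <= h ->
  trunc_riesz l eta t w <= (1 + 8 * h / eta) * trunc_riesz l eta t z.
Proof.
move=> /andP[l0 l1] eta0 St Sz Sw h1 h2.
have h0 : 0 <= h by rewrite (le_trans _ h1).
set u := Num.max (sqdist t z) eta; set v := Num.max (sqdist t w) eta.
have eta_v : eta <= v by rewrite le_max lexx orbT.
have u0 : 0 < u by rewrite lt_max eta0 orbT.
have v0 : 0 < v by rewrite lt_max eta0 orbT.
set c := 1 + 8 * h / eta.
have c1 : 1 <= c by rewrite lerDl divr_ge0 ?mulr_ge0// ltW.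
have c0 : 0 < c by rewrite (lt_le_trans _ c1).
have uv : u <= c * v.
  rewrite /c mulrDl mul1r (@le_trans _ _ (v + 8 * h))//.
    rewrite /u ge_max; apply/andP; split.
      rewrite (le_trans (sqdist_lip _ _ _ _ St Sz Sw h1 h2))//.
      by rewrite lerD2r le_max lexx.
    by rewrite (le_trans eta_v)// lerDl mulr_ge0.
  rewrite lerD2l -mulrA ler_peMr ?mulr_ge0//.
  by rewrite mulrC ler_pdivlMr// mul1r.
rewrite /trunc_riesz -/u -/v.
rewrite -ler_pdivrMl// -powR_inv1 ?(ltW c0)//.
rewrite (@le_trans _ _ (c `^ (- l) * v `^ (- l)))//.
  by rewrite ler_wpM2r ?powR_ge0// ler_powR// lerN2.
rewrite -powRM ?(ltW c0) ?(ltW v0)//.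
exact: powRN_antimono.
Qed.

End Truncation.

(** * The mean of the modulus on a cell *)

Section CellMean.
Context {R : realType}.
Local Notation mu := (@lebesgue_measure R).
Local Notation mu2 := (@lebesgue_measure R \x @lebesgue_measure R)%E.
Local Notation T2 := (measurableTypeR R * measurableTypeR R)%type.

Lemma integral_rect_fst (A B : set R) (h : R -> \bar R) :
  measurable A -> measurable B -> measurable_fun setT h -> (forall x, (0 <= h x)%E) ->
  (\int[mu2]_(z in A `*` B) h z.1 = \int[mu]_(x in A) h x * mu B)%E.
Proof.
move=> mA mB mh h0.
have mh1 : measurable_fun [set: T2] (fun z => h z.1).
  exact: (measurableT_comp mh).
have [_ ->] := tonelli_rect _ _ _ mA mB mh1 (fun z => h0 z.1).
by rewrite /= integral_cst// muleC.
Qed.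

Lemma integral_rect_snd (A B : set R) (h : R -> \bar R) :
  measurable A -> measurable B -> measurable_fun setT h -> (forall x, (0 <= h x)%E) ->
  (\int[mu2]_(z in A `*` B) h z.2 = \int[mu]_(y in B) h y * mu A)%E.
Proof.
move=> mA mB mh h0.
have mh2 : measurable_fun [set: T2] (fun z => h z.2).
  exact: (measurableT_comp mh).
have [-> _] := tonelli_rect _ _ _ mA mB mh2 (fun z => h0 z.2).
by rewrite /= integral_cst// muleC.
Qed.

Lemma point_null (t : R * R) :
  measurable ([set t] : set T2) /\ mu2 [set t] = 0%E.
Proof.
have -> : [set t] = [set t.1] `*` [set t.2].
  by apply/seteqP; split => [z ->//|[? ?] [/= -> ->]]; rewrite -surjective_pairing.
split; first exact: measurableX.
by rewrite product_measure1E//= lebesgue_measure_set1 mul0e.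
Qed.

(** Each of the two terms of the modulus has mean h^alpha / (1 + alpha): this is
    where the constant 2 / (1 + alpha) of the error bound comes from. *)
Lemma integral_modulus (alpha h a b : R) : 0 <= alpha -> 0 < h ->
  (\int[mu2]_(z in rect (a - h) (a + h) (b - h) (b + h)) (modulus alpha (a, b) z)%:E =
   ((2 * h) ^+ 2 * (2 * h `^ alpha / (1 + alpha)))%:E)%E.
Proof.
move=> alpha0 h0.
pose d (c x : R) := (`|x - c| `^ alpha)%:E.
have md c : measurable_fun setT (d c).
  apply/measurable_EFinP.
  apply: (@measurableT_comp _ _ _ _ _ _ (@powR R ^~ alpha)) => //.
  by apply: measurableT_comp => //; exact: measurable_funB.
have d0 c x : (0 <= d c x)%E by rewrite lee_fin powR_ge0.
have int_d c : (\int[mu]_(x in `[(c - h)%R, (c + h)%R]) d c x =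
    (2 * h `^ (alpha + 1) / (alpha + 1))%:E)%E.
  by apply: integral_powR_itv => //; lra.
have len c : (mu `[(c - h)%R, (c + h)%R] = (2 * h)%:E)%E.
  rewrite lebesgue_measure_itv/= lte_fin ltrBlDr -addrA ltrDl.
  rewrite addr_gt0// -EFinD; congr EFin; ring.
have -> : (\int[mu2]_(z in rect (a - h) (a + h) (b - h) (b + h)) (modulus alpha (a, b) z)%:E =
    \int[mu2]_(z in rect (a - h) (a + h) (b - h) (b + h)) (d a z.1 + d b z.2))%E.
  by apply: eq_integral => z _; rewrite -EFinD.
rewrite ge0_integralD//; last 3 first.
- exact: measurable_rect.
- apply: (measurable_funS measurableT) => //.
  exact: (measurableT_comp (md a)).
- apply: (measurable_funS measurableT) => //.
  exact: (measurableT_comp (md b)).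
rewrite integral_rect_fst// integral_rect_snd// !int_d.
rewrite (len a) (len b) -!EFinM -EFinD; congr EFin.
rewrite powRD; last by rewrite (gt_eqF h0) implybT.
by rewrite powRr1 ?(ltW h0)// (addrC alpha 1); field; rewrite gt_eqF//; lra.
Qed.

Lemma integrable_modulus (alpha h a b : R) : 0 <= alpha -> 0 < h ->
  mu2.-integrable (rect (a - h) (a + h) (b - h) (b + h)) (EFin \o modulus alpha (a, b)).
Proof.
move=> alpha0 h0; apply/integrableP; split.
  apply: (measurable_funS measurableT) => //; apply/measurable_EFinP.
  exact: measurable_modulus.
under eq_integral do rewrite /= ger0_norm ?modulus_ge0//.
by rewrite integral_modulus// ltry.
Qed.

End CellMean.

(** * Upper bound for the midpoint formula *)

Section Upper.
Context {R : realType} {n : nat}.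
Context (n_gt0 : (0 < n)%N).
Local Notation mu := (@lebesgue_measure R).
Local Notation mu2 := (@lebesgue_measure R \x @lebesgue_measure R)%E.
Local Notation T2 := (measurableTypeR R * measurableTypeR R)%type.
Local Notation m := (@midpoint R n).
Local Notation h := (n%:R^-1 : R).

Let nR_gt0 : 0 < n%:R :> R. Proof. by rewrite ltr0n. Qed.
Let h_gt0 : 0 < h. Proof. by rewrite invr_gt0. Qed.

Let integrable_cell f (k l : 'I_n) : mu2.-integrable square (EFin \o f) ->
  mu2.-integrable (cell k l) (EFin \o f).
Proof.
move=> intf.
exact: (integrableS measurable_square (measurable_cell k l)
  (cell_square n_gt0 k l) intf).
Qed.

Let measure_cell (k l : 'I_n) : mu2 (cell k l) = ((2 * h) ^+ 2)%:E.
Proof.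
rewrite cellE// measure_rect; last 2 first.
- by have := h_gt0; lra.
- by have := h_gt0; lra.
by congr EFin; ring.
Qed.

(** Returns from the truncated kernel at a midpoint to the kernel itself, so that
    the cell contributions add up to the integral of the kernel over the square.
    The only exceptional point is [z = t], where the kernel is 0. *)
Lemma trunc_riesz_mid_le (lam eta : R) t (k l : 'I_n) :
  0 < lam < 1 -> 0 < eta -> square t ->
  trunc_riesz lam eta t (m k, m l) * (2 * h) ^+ 2 <=
  (1 + 8 * h / eta) * \int[mu2]_(z in cell k l) riesz lam t z.
Proof.
move=> /[dup] l01 /andP[l0 l1] eta0 St.
have c0 : 0 < 1 + 8 * h / eta.
  by rewrite ltr_pwDl// divr_ge0 ?(ltW eta0)// mulr_ge0// ltW.
rewrite -ler_pdivrMl//.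
set C := _^-1 * _.
have intK : mu2.-integrable (cell k l) (EFin \o riesz lam t).
  by apply: integrable_cell; exact: integrable_riesz.
have mc : measurable (cell k l : set T2) := measurable_cell k l.
have finK := integrable_fin_num mc intK.
rewrite -lee_fin fineK//.
have -> : C%:E = (\int[mu2]_(z in cell k l)
    ((1 + 8 * h / eta)^-1 * trunc_riesz lam eta t (m k, m l))%:E)%E.
  rewrite integral_cst//; transitivity (((1 + 8 * h / eta)^-1 *
      trunc_riesz lam eta t (m k, m l))%:E * mu2 (cell k l))%E; last by [].
  by rewrite measure_cell -EFinM /C mulrA.
apply: ae_ge0_le_integral => //.
- by move=> z _; rewrite lee_fin mulr_ge0 ?powR_ge0// invr_ge0 ltW.
- by move=> z _; rewrite lee_fin riesz_ge0.
- by case/integrableP : intK.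
exists [set t]; split; [exact: (point_null t).1|exact: (point_null t).2|].
move=> z /= H; apply: contrapT => /eqP zt; apply: H => cz.
rewrite lee_fin ler_pdivrMl//.
have [z1 z2] := cell_dist n_gt0 _ _ _ cz.
have Sz := cell_square n_gt0 _ _ _ cz.
have Sm : square (m k, m l) := cell_square n_gt0 _ _ _ (cell_midpoint n_gt0 k l).
have l0l1 : 0 <= lam <= 1 by rewrite !ltW.
rewrite (le_trans (trunc_riesz_harnack lam eta t z (m k, m l) h l0l1 eta0 St Sz Sm z1 z2))//.
by rewrite ler_pM2l// trunc_le_riesz// ltW.
Qed.

(** In the first summand the truncated kernel is frozen at the midpoint, so the mean
    of the modulus comes out; one factor [1 + 8 * h / eta] is paid for freezing it
    and one for going back.  In the second summand the modulus is bounded by its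
    maximum 2 h^alpha, since the cut-off part of the kernel is small anyway. *)
Lemma cell_error_le (lam lam' alpha eta : R) f t (k l : 'I_n) :
  0 < lam -> lam < lam' -> lam' < 1 -> 0 < alpha -> 0 < eta -> square t ->
  holder_class alpha f ->
  `|\int[mu2]_(z in cell k l) (f z * riesz lam t z)
    - cell_weight lam k l t * f (m k, m l)| <=
  (1 + 8 * h / eta) ^+ 2 * (2 * h `^ alpha / (1 + alpha)) *
    (\int[mu2]_(z in cell k l) riesz lam t z)
  + 2 * h `^ alpha * eta `^ (lam' - lam) *
    (\int[mu2]_(z in cell k l) riesz lam' t z).
Proof.
move=> l0 ll' l'1 alpha0 eta0 St Hf.
have l01 : 0 < lam < 1 by rewrite l0 (lt_trans ll').
have l01' : 0 < lam' < 1 by rewrite l'1 (lt_trans l0).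
have mc : measurable (cell k l : set T2) := measurable_cell k l.
have intK : mu2.-integrable (cell k l) (EFin \o riesz lam t).
  by apply: integrable_cell; exact: integrable_riesz.
have intK' : mu2.-integrable (cell k l) (EFin \o riesz lam' t).
  by apply: integrable_cell; exact: integrable_riesz.
have intfK : mu2.-integrable (cell k l) (EFin \o (fun z => f z * riesz lam t z)).
  by apply: integrable_cell; exact: (integrable_holder_riesz lam t alpha).
have intG : mu2.-integrable (cell k l) (EFin \o modulus alpha (m k, m l)).
  by rewrite cellE//; apply: integrable_modulus => //; exact: ltW.
pose fm := f (m k, m l).
have intZ (c : R) (g : R * R -> R) : mu2.-integrable (cell k l) (EFin \o g) ->
    mu2.-integrable (cell k l) (EFin \o (fun z => c * g z)).
  move=> intg; have -> : EFin \o (fun z => c * g z) = (fun z => c%:E * (EFin \o g) z)%E.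
    by apply/funext => z /=; rewrite EFinM.
  exact: integrableZl.
have intmK := intZ fm _ intK.
have intD (g1 g2 : R * R -> R) : mu2.-integrable (cell k l) (EFin \o g1) ->
    mu2.-integrable (cell k l) (EFin \o g2) ->
    mu2.-integrable (cell k l) (EFin \o (fun z => g1 z + g2 z)).
  move=> i1 i2; have -> : EFin \o (fun z => g1 z + g2 z) =
      ((EFin \o g1) \+ (EFin \o g2))%E.
    by apply/funext => z /=; rewrite EFinD.
  exact: integrableD.
have intB : mu2.-integrable (cell k l)
    (EFin \o (fun z => f z * riesz lam t z - fm * riesz lam t z)).
  have -> : (fun z => f z * riesz lam t z - fm * riesz lam t z) =
      (fun z => f z * riesz lam t z + (- fm) * riesz lam t z).
    by apply/funext => z; rewrite mulNr.
  by apply: intD => //; exact: intZ.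
rewrite /cell_weight /lebesgue2 mulrC -(RintegralZl fm mc intK).
rewrite -(RintegralB mc intfK intmK).
apply: (le_trans (le_normr_Rintegral mc intB)).
pose c1 := (1 + 8 * h / eta) * trunc_riesz lam eta t (m k, m l).
pose c2 := 2 * h `^ alpha * eta `^ (lam' - lam).
apply: (@le_trans _ _ (\int[mu2]_(z in cell k l)
    (c1 * modulus alpha (m k, m l) z + c2 * riesz lam' t z))).
  apply: le_Rintegral => //.
  - exact: integrable_norm.
  - by apply: intD; apply: intZ.
  move=> z cz.
  have [z1 z2] := cell_dist n_gt0 _ _ _ cz.
  have Sz := cell_square n_gt0 _ _ _ cz.
  have Sm : square (m k, m l) := cell_square n_gt0 _ _ _ (cell_midpoint n_gt0 k l).
  have fG : `|f z - fm| <= modulus alpha (m k, m l) z by exact: Hf.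
  have G2 : modulus alpha (m k, m l) z <= 2 * h `^ alpha.
    by apply: modulus_le => //; exact: ltW.
  rewrite -mulrBl normrM [X in _ * X]ger0_norm ?riesz_ge0//.
  rewrite (@le_trans _ _ (modulus alpha (m k, m l) z * riesz lam t z))//.
    by rewrite ler_wpM2r ?riesz_ge0.
  rewrite (@le_trans _ _ (modulus alpha (m k, m l) z *
      (trunc_riesz lam eta t z + eta `^ (lam' - lam) * riesz lam' t z)))//.
    by rewrite ler_wpM2l ?modulus_ge0// riesz_le_trunc.
  rewrite mulrDr lerD//.
    rewrite mulrC ler_wpM2r ?modulus_ge0//.
    apply: (trunc_riesz_harnack lam eta t (m k, m l) z) => //.
    - by rewrite !ltW//; case/andP: l01.
    - by rewrite distrC.
    - by rewrite distrC.
  rewrite /c2 -[leRHS]mulrA ler_wpM2r//.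
  by rewrite mulr_ge0 ?powR_ge0 ?riesz_ge0.
rewrite RintegralD//; [|exact: intZ|exact: intZ].
rewrite RintegralZl// RintegralZl// lerD//.
have -> : \int[mu2]_(z in cell k l) modulus alpha (m k, m l) z =
    (2 * h) ^+ 2 * (2 * h `^ alpha / (1 + alpha)).
  by rewrite /Rintegral cellE// integral_modulus// ltW.
rewrite /c1 expr2 -mulrA -[leRHS]mulrA -[leRHS]mulrA ler_wpM2l//.
  by rewrite addr_ge0// divr_ge0 ?(ltW eta0)// mulr_ge0// ltW.
rewrite mulrA [leRHS]mulrCA [leRHS]mulrC ler_wpM2r//.
  by rewrite divr_ge0 ?mulr_ge0 ?powR_ge0//; lra.
exact: trunc_riesz_mid_le.
Qed.

(** The truncation level [eta] is still free: a large one makes the first correction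
    small, a small one the second. *)
Lemma remainder_le (lam lam' alpha eta : R) f t :
  0 < lam -> lam < lam' -> lam' < 1 -> 0 < alpha -> 0 < eta -> square t ->
  holder_class alpha f ->
  `|remainder lam (@cell_weight R lam n) m m f t| <=
  2 / ((1 + alpha) * n%:R `^ alpha) *
  ((1 + 8 * h / eta) ^+ 2 * (\int[mu2]_(z in square) riesz lam (0, 0) z)
   + (1 + alpha) * eta `^ (lam' - lam) *
     (\int[mu2]_(z in square) riesz lam' (0, 0) z)).
Proof.
move=> l0 ll' l'1 alpha0 eta0 St Hf.
have l01 : 0 < lam < 1 by rewrite l0 (lt_trans ll').
have l01' : 0 < lam' < 1 by rewrite l'1 (lt_trans l0).
rewrite /remainder /riesz_op /lebesgue2.
rewrite (integral_square_cells n_gt0); last first.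
  exact: (integrable_holder_riesz lam t alpha).
rewrite -sumrB; under eq_bigr do rewrite -sumrB.
rewrite (le_trans (ler_norm_sum _ _ _))//.
apply: (@le_trans _ _ (\sum_(k < n) \sum_(l < n)
  ((1 + 8 * h / eta) ^+ 2 * (2 * h `^ alpha / (1 + alpha)) *
    (\int[mu2]_(z in cell k l) riesz lam t z)
  + 2 * h `^ alpha * eta `^ (lam' - lam) *
    (\int[mu2]_(z in cell k l) riesz lam' t z)))).
  apply: ler_sum => k _; rewrite (le_trans (ler_norm_sum _ _ _))//.
  by apply: ler_sum => l _; exact: cell_error_le.
under eq_bigr do rewrite big_split -!mulr_sumr/=.
rewrite big_split -!mulr_sumr/=.
rewrite -(integral_square_cells n_gt0); last exact: integrable_riesz.
rewrite -(integral_square_cells n_gt0); last exact: integrable_riesz.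
have hE : h `^ alpha = (n%:R `^ alpha)^-1.
  by rewrite -powR_inv1 ?ltW// -powRrM mulN1r powRN.
rewrite mulrDr lerD//.
  rewrite [leRHS]mulrA hE.
  rewrite [X in X * _ <= _](_ : _ = 2 / ((1 + alpha) * n%:R `^ alpha) *
    (1 + 8 * n%:R^-1 / eta) ^+ 2); last first.
    by rewrite invfM; ring.
  rewrite ler_wpM2l ?Rintegral_riesz_center//.
  by rewrite mulr_ge0 ?sqr_ge0// divr_ge0// mulr_ge0 ?powR_ge0//; lra.
rewrite !mulrA hE.
rewrite [X in X * _ <= _](_ : _ = 2 / ((1 + alpha) * n%:R `^ alpha) * (1 + alpha) *
    eta `^ (lam' - lam)); last first.
  by field; rewrite !gt_eqF ?powR_gt0//; lra.
rewrite ler_wpM2l ?Rintegral_riesz_center//.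
rewrite mulr_ge0 ?powR_ge0// mulr_ge0//; last by lra.
by rewrite divr_ge0// mulr_ge0 ?powR_ge0//; lra.
Qed.

End Upper.

(** * Lower bound for an arbitrary formula *)

Section Lower.
Context {R : realType}.
Local Notation mu := (@lebesgue_measure R).
Local Notation mu2 := (@lebesgue_measure R \x @lebesgue_measure R)%E.
Local Notation T2 := (measurableTypeR R * measurableTypeR R)%type.

Lemma square_center : square ((0, 0) : R * R).
Proof. by split; rewrite /= in_itv/=; apply/andP; split; lra. Qed.

(** At every point of the square other than the centre the squared distance to the
    centre is positive and at most 2. *)
Lemma integral_riesz_ge (lam c : R) (f : R * R -> R) (B : set (R * R)) :
  0 <= lam -> 0 <= c -> measurable (B : set T2) -> B `<=` square ->
  measurable_fun (square : set T2) f -> (forall z, square z -> 0 <= f z) ->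
  (forall z, B z -> c <= f z) ->
  ((c * 2 `^ (- lam))%:E * mu2 B <=
   \int[mu2]_(z in square) (f z * riesz lam (0%R, 0%R) z)%:E)%E.
Proof.
move=> l0 c0 mB BS mf f0 fc.
have mfK : measurable_fun (square : set T2)
    (fun z => (f z * riesz lam (0%R, 0%R) z)%:E).
  apply/measurable_EFinP; apply: measurable_funM => //.
  by apply: (measurable_funS measurableT) => //; exact: measurable_riesz.
have fK0 z : square z -> (0 <= (f z * riesz lam (0%R, 0%R) z)%:E)%E.
  by move=> Sz; rewrite lee_fin mulr_ge0 ?f0 ?riesz_ge0.
apply: (@le_trans _ _ (\int[mu2]_(z in B) (f z * riesz lam (0%R, 0%R) z)%:E)%E); last first.
  by apply: ge0_subset_integral => //; exact: measurable_square.
have -> : ((c * 2 `^ (- lam))%:E * mu2 B =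
    \int[mu2]_(z in B) (c * 2 `^ (- lam))%:E)%E by rewrite integral_cst.
apply: ae_ge0_le_integral => //.
- by move=> z _; rewrite lee_fin mulr_ge0 ?powR_ge0.
- by move=> z Bz; exact: fK0 (BS _ Bz).
- by apply: measurable_funS mfK => //; exact: measurable_square.
exists [set (0, 0)]; split; [exact: (point_null _).1|exact: (point_null _).2|].
move=> z /= H; apply: contrapT => /eqP z0; apply: H => Bz.
rewrite lee_fin ler_pM ?powR_ge0 ?fc//.
rewrite rieszE; apply: powRN_antimono => //.
  by rewrite lt_neqAle eq_sym sqdist_eq0 z0 sqdist_ge0.
have [] := BS _ Bz; rewrite /= !in_itv/= /sqdist/= !subr0 => z1 z2.
have sq1 (s : R) : -1 <= s <= 1 -> s ^+ 2 <= 1.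
  by rewrite -ler_norml => s1; rewrite -(real_normK (num_real s)) expr_le1.
by have := sq1 _ z1; have := sq1 _ z2; lra.
Qed.

Lemma Rintegral_riesz_gt0 (lam : R) : 0 < lam < 1 ->
  0 < \int[mu2]_(z in square) riesz lam (0, 0) z.
Proof.
move=> l01; have /andP[l0 l1] := l01.
have := integral_riesz_ge lam 1 (cst 1) square (ltW l0) ler01 measurable_square.
move=> /(_ (fun _ p => p) (measurable_cst _) (fun _ _ => ler01) (fun _ _ => lexx _)).
rewrite /square measure_rect; [|lra|lra].
rewrite mul1r => Hge.
rewrite -lte_fin /Rintegral fineK; last first.
  apply: integrable_fin_num; first exact: measurable_square.
  exact: (integrable_riesz lam _ l01 square_center).
apply: (@lt_le_trans _ _ ((2 `^ (- lam) * ((1 - -1) * (1 - -1)))%:E)).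
  by rewrite lte_fin mulr_gt0 ?powR_gt0//; lra.
rewrite EFinM (le_trans Hge)// le_eqVlt; apply/orP; left; apply/eqP.
by apply: eq_integral => z _; rewrite mul1r.
Qed.

(** With s = a + b, each fraction a / s is at most (a / s)^alpha because it lies in
    [0, 1] and alpha <= 1; add the two and multiply by s^alpha. *)
Lemma powR_subadditive (alpha a b : R) : 0 < alpha <= 1 -> 0 <= a -> 0 <= b ->
  (a + b) `^ alpha <= a `^ alpha + b `^ alpha.
Proof.
move=> /andP[a0 a1] ha hb.
have [s0|s0] := eqVneq (a + b) 0.
  by rewrite s0 powR0 ?gt_eqF// addr_ge0 ?powR_ge0.
have sgt0 : 0 < a + b by rewrite lt_neqAle eq_sym s0 addr_ge0.
have part c : 0 <= c -> c <= a + b -> c / (a + b) * (a + b) `^ alpha <= c `^ alpha.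
  rewrite le_eqVlt => /predU1P[<-|c0 cs]; first by rewrite !mul0r powR_ge0.
  rewrite -[in leRHS](divfK s0 c) powRM ?divr_ge0 ?(ltW c0) ?(ltW sgt0)//.
  rewrite ler_wpM2r ?powR_ge0// ger1_powR// divr_gt0//= ler_pdivrMr// mul1r//.
rewrite (@le_trans _ _ (a / (a + b) * (a + b) `^ alpha + b / (a + b) * (a + b) `^ alpha))//.
  by rewrite -mulrDl -mulrDl divff// mul1r.
by rewrite lerD// part// ?lerDl ?lerDr.
Qed.

Section Bump.
Context {n : nat} (x : 'I_n -> R) (alpha : R).

Definition strip (c d : R) : set (R * R) := `]c - d, c + d[ `*` `[-1, 1].

(** The cap at 1 gives the minimum a value in the absence of nodes; it stays above
    the value (2n)^(-alpha) that is needed away from the nodes. *)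
Definition node_bump (z : R * R) : R :=
  \big[Num.min/1]_(k < n) `|z.1 - x k| `^ alpha.

Lemma node_bump_ge0 z : 0 <= node_bump z.
Proof. by apply: le_bigmin => // k _; rewrite powR_ge0. Qed.

Lemma node_bump_node k s : 0 < alpha -> node_bump (x k, s) = 0.
Proof.
move=> alpha0; apply/eqP; rewrite eq_le node_bump_ge0 andbT.
by rewrite (le_trans (bigmin_le _ k _))//= subrr normr0 powR0// gt_eqF.
Qed.

Lemma holder_node_bump : 0 < alpha <= 1 -> holder_class alpha node_bump.
Proof.
move=> alpha01 u v _ _.
have lip u' v' : node_bump u' <= node_bump v' + `|u'.1 - v'.1| `^ alpha.
  rewrite /node_bump; apply: (big_ind2 (fun a b => a <= b + `|u'.1 - v'.1| `^ alpha)).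
  - by rewrite lerDl powR_ge0.
  - move=> a a' b b' aa' bb'; rewrite /Num.min.
    by case: ifPn; case: ifPn; rewrite -?leNgt => ? ?; lra.
  - move=> k _; rewrite -(addrC (`|u'.1 - v'.1| `^ alpha)).
    rewrite (le_trans _ (powR_subadditive _ _ _ alpha01 _ _))//.
    apply: ge0_ler_powR; rewrite ?nnegrE ?addr_ge0//; first by case/andP: alpha01 => /ltW.
    by rewrite (le_trans _ (ler_normD _ _))// addrA subrK.
rewrite (@le_trans _ _ (`|u.1 - v.1| `^ alpha))//; last by rewrite lerDl powR_ge0.
rewrite ler_norml lerBlDl lip andbT lerNl opprB lerBlDl distrC.
exact: lip.
Qed.

Lemma measurable_strips (d : R) :
  measurable (\big[setU/set0]_(k < n) strip (x k) d : set T2).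
Proof. by apply: bigsetU_measurable => k _; exact: measurableX. Qed.

(** The strips have total area at most 4 n d <= 2, half of the square. *)
Lemma measure_away_nodes (d : R) : 0 <= d -> n%:R * d <= 2^-1 ->
  (2%:E <= mu2 (square `\` \big[setU/set0]_(k < n) strip (x k) d))%E.
Proof.
move=> d0 nd.
set U := \big[setU/set0]_(k < n) _.
have mU : measurable (U : set T2) by exact: measurable_strips.
have muU : (mu2 U <= 2%:E)%E.
  apply: (@le_trans _ _ (\sum_(k < n) (4 * d)%:E)%E).
    suff [] : measurable (U : set T2) /\ (mu2 U <= \sum_(k < n) (4 * d)%:E)%E by [].
    apply: (big_ind2 (fun (A : set T2) s => measurable A /\ (mu2 A <= s)%E)).
    - by rewrite measure0.
    - move=> A s A' s' [mA As] [mA' As']; split; first exact: measurableU.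
      by rewrite (le_trans (measureU2 _ mA mA'))// leeD.
    - move=> k _; split; first exact: measurableX.
      rewrite /strip product_measure1E//= !lebesgue_measure_itv/= !lte_fin.
      rewrite [X in (_ * X)%E]ifT; last by lra.
      case: ifPn => _; last by rewrite mul0e lee_fin mulr_ge0.
      by rewrite -!EFinD -EFinM lee_fin; lra.
  rewrite sumEFin lee_fin sumr_const card_ord -[leLHS]mulr_natl mulrCA; lra.
have mS := @measurable_square R.
have : (4%:E <= mu2 (square `\` U) + 2%:E)%E.
  apply: (@le_trans _ _ (mu2 (square `\` U) + mu2 U))%E; last by rewrite leeD2l.
  have -> : 4%:E = mu2 square :> \bar R.
    by rewrite /square measure_rect; [congr EFin; ring|lra|lra].
  apply: (@le_trans _ _ (mu2 ((square `\` U) `|` U))).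
    by rewrite le_measure ?inE//; [apply: measurableU => //; exact: measurableD|
      move=> z Sz; have [|] := pselect (U z); [right|left]].
  by apply: measureU2 => //; exact: measurableD.
rewrite -leeBlDr// -EFinB; apply: le_trans; rewrite lee_fin; lra.
Qed.

(** The remainder on [node_bump] at the centre is the full integral, because the
    cubature sum is 0. *)
Lemma error_node_bump (lam : R) (p : coefficients n) (y : 'I_n -> R) :
  (0 < n)%N -> 0 < lam < 1 -> 0 < alpha <= 1 ->
  ((2 * 2 `^ (- lam) * 2 `^ (- alpha) / n%:R `^ alpha)%:E <=
   error lam p x y (holder_class alpha))%E.
Proof.
move=> n0 l01 alpha01.
have [l0 l1] := andP l01; have [a0 a1] := andP alpha01.
have n0R : 0 < n%:R :> R by rewrite ltr0n.
have H := holder_node_bump alpha01.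
have int_f := integrable_holder_riesz lam (0, 0) alpha node_bump l01 square_center a0 H.
apply: (@le_trans _ _ `|remainder lam p x y node_bump (0, 0)|%:E); last first.
  apply: ereal_sup_ubound; exists node_bump, (0, 0); split => //.
  exact: square_center.
rewrite /remainder big1 ?subr0; last first.
  by move=> k _; rewrite big1// => l _; rewrite node_bump_node// mulr0.
rewrite /riesz_op /lebesgue2 ger0_norm; last first.
  by apply: Rintegral_ge0 => z _; rewrite mulr_ge0 ?node_bump_ge0 ?riesz_ge0.
rewrite /Rintegral fineK; last first.
  by apply: integrable_fin_num int_f; exact: measurable_square.
(* n strips of half-width 1 / (2n) leave half of the square uncovered. *)
pose d : R := (2 * n%:R)^-1.
have d0 : 0 < d by rewrite invr_gt0 mulr_gt0.
have nd : n%:R * d = 2^-1 by rewrite /d; field; rewrite gt_eqF.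
pose B := square `\` \big[setU/set0]_(k < n) strip (x k) d.
have mB : measurable (B : set T2).
  by apply: measurableD; [exact: measurable_square|exact: measurable_strips].
have BS : B `<=` square by move=> z [].
have fB z : B z -> d `^ alpha <= node_bump z.
  move=> [[z1 z2] nUz]; apply: le_bigmin => [|k _].
    have -> : 1 = 1 `^ alpha :> R by rewrite powR1.
    apply: ge0_ler_powR; rewrite ?nnegrE ?(ltW a0) ?(ltW d0)//.
    by rewrite /d invf_le1 ?mulr_gt0// -[leLHS]mulr1 ler_pM// ?ler1n//; lra.
  apply: ge0_ler_powR; rewrite ?nnegrE ?(ltW a0) ?(ltW d0)//.
  rewrite leNgt; apply/negP => zk; apply: nUz.
  rewrite -bigcup_seq; exists k; first by rewrite /= mem_index_enum.
  split => //; rewrite /= in_itv/=.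
  by move: zk; rewrite ltr_distl.
apply: le_trans (integral_riesz_ge lam (d `^ alpha) node_bump B (ltW l0) (powR_ge0 _ _)
  mB BS (measurable_holder _ _ a0 H) (fun z _ => node_bump_ge0 z) fB).
have B2 : (2%:E <= mu2 B)%E by apply: measure_away_nodes; rewrite ?nd// ltW.
apply: (@le_trans _ _ ((d `^ alpha * 2 `^ (- lam))%:E * 2%:E)%E); last first.
  by rewrite lee_pmul2l// lte_fin mulr_gt0 ?powR_gt0.
rewrite -EFinM lee_fin.
have -> : d `^ alpha = 2 `^ (- alpha) / n%:R `^ alpha.
  rewrite /d -powR_inv1 ?mulr_ge0 ?ltW// -powRrM mulN1r powRM ?ltW//.
  by rewrite [X in _ * X]powRN.
by rewrite le_eqVlt; apply/orP; left; apply/eqP; ring.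
Qed.

End Bump.

End Lower.

(** * The order of the error *)

Section Asymptotics.
Context {R : realType}.

Lemma cvg_powRN0 (a : R) : 0 < a -> n%:R `^ (- a) @[n --> \oo] --> (0 : R).
Proof.
move=> a0; apply/cvgrPdist_le => e e0; near=> n.
have n0 : 0 < n%:R :> R by rewrite ltr0n; near: n; exact: nbhs_infty_gt.
rewrite sub0r normrN ger0_norm ?powR_ge0// powRN.
rewrite -[leRHS]invrK lef_pV2 ?posrE ?powR_gt0 ?invr_gt0//.
have -> : e^-1 = (e^-1 `^ a^-1) `^ a.
  by rewrite -powRrM mulVf ?gt_eqF// powRr1// invr_ge0 ltW.
apply: ge0_ler_powR; rewrite ?nnegrE ?powR_ge0 ?(ltW a0) ?ler0n//.
by near: n; exact: nbhs_infty_ger.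
Unshelve. all: end_near. Qed.

End Asymptotics.

Theorem theorem6p4 (R : realType) (lambda alpha : R)
    (hlambda : 0 < lambda < 1) (halpha : 0 < alpha <= 1) :
  optimal_order lambda (cell_weight lambda) (@midpoint R) (@midpoint R)
    (holder_class alpha)
  /\ exists eps : nat -> R, eps n @[n --> \oo] --> (0 : R) /\
     \forall n \near \oo,
       let A := (1 + eps n) * (2 / ((1 + alpha) * n%:R `^ alpha)) in
       let S := ereal_sup [set e | exists2 t, square t &
         e = (\int[lebesgue2]_(tau in square) (riesz lambda t tau)%:E)%E] in
       let J := (\int[lebesgue2]_(tau in square)
         (((tau.1 ^+ 2 + tau.2 ^+ 2) `^ lambda)^-1)%:E)%E in
       (error lambda (cell_weight lambda (n := n))
          (@midpoint R n) (@midpoint R n) (holder_class alpha) <= A%:E * S)%E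
       /\ (A%:E * S <= A%:E * J)%E.
Proof.
have [l0 l1] := andP hlambda; have [a0 a1] := andP halpha.
pose lam' := (1 + lambda) / 2.
have ll' : lambda < lam' by rewrite /lam'; lra.
have l'1 : lam' < 1 by rewrite /lam'; lra.
pose I l : R := \int[(@lebesgue_measure R \x @lebesgue_measure R)%E]_(z in square)
  riesz l (0, 0) z.
have I0 : 0 < I lambda := Rintegral_riesz_gt0 lambda hlambda.
(* [remainder_le] at eta = n^(-1/2), divided by the leading term. *)
pose eps (n : nat) : R := ((1 + 8 * n%:R `^ (- 2^-1)) ^+ 2 - 1) +
  (1 + alpha) * I lam' / I lambda * n%:R `^ (- (2^-1 * (lam' - lambda))).
have eps_ge0 n : 0 <= eps n.
  rewrite /eps addr_ge0//.
    rewrite subr_ge0 exprn_ege1// lerDl mulr_ge0// powR_ge0//.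
  rewrite mulr_ge0 ?powR_ge0// divr_ge0 ?(ltW I0)// mulr_ge0//; first by lra.
  by apply: Rintegral_ge0 => z _; exact: riesz_ge0.
have cvg_eps : eps n @[n --> \oo] --> (0 : R).
  rewrite -[X in _ --> X](_ : ((1 + 8 * 0) * (1 + 8 * 0) - 1) +
    (1 + alpha) * I lam' / I lambda * 0 = 0); last by rewrite !mulr0 !addr0 mulr1 subrr.
  have c1 : (fun n : nat => 1 + 8 * n%:R `^ (- 2^-1)) @ \oo --> (1 + 8 * 0 : R).
    apply: cvgD; first exact: cvg_cst.
    by apply: cvgMr; exact: cvg_powRN0.
  apply: cvgD; last first.
    by apply: cvgMr; apply: cvg_powRN0; rewrite mulr_gt0// subr_gt0.
  apply: cvgB; last exact: cvg_cst.
  by apply: cvgM.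
pose A0 (n : nat) : R := 2 / ((1 + alpha) * n%:R `^ alpha).
have error_le n : (0 < n)%N -> (error lambda (cell_weight lambda (n := n))
    (@midpoint R n) (@midpoint R n) (holder_class alpha) <=
    ((1 + eps n) * A0 n * I lambda)%:E)%E.
  move=> n0; have n0R : 0 < n%:R :> R by rewrite ltr0n.
  apply: ge_ereal_sup => _ [f [t [Hf St ->]]]; rewrite lee_fin.
  have eta0 : 0 < n%:R `^ (- 2^-1) :> R by rewrite powR_gt0.
  have := remainder_le n0 lambda lam' alpha _ f t l0 ll' l'1 a0 eta0 St Hf.
  move=> /le_trans; apply; rewrite -/(A0 n) -/(I lambda) -/(I lam').
  rewrite -powRrM mulNr.
  have -> : 8 * n%:R^-1 / n%:R `^ (- 2^-1) = 8 * n%:R `^ (- 2^-1) :> R.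
    rewrite -mulrA; congr (_ * _).
    rewrite -[n%:R^-1]powR_inv1 ?ler0n// -powRN -powRD; last first.
      by rewrite (gt_eqF n0R) implybT.
    by congr (_ `^ _); lra.
  rewrite [leRHS]mulrAC [leRHS]mulrC; apply: ler_wpM2l.
    by rewrite /A0 divr_ge0// mulr_ge0 ?powR_ge0//; lra.
  rewrite le_eqVlt; apply/orP; left; apply/eqP.
  by rewrite /eps; field; rewrite gt_eqF.
pose L : R := 2 * 2 `^ (- lambda) * 2 `^ (- alpha).
have L0 : 0 < L by rewrite !mulr_gt0 ?powR_gt0.
have zeta_ge n : (0 < n)%N ->
    ((L / n%:R `^ alpha)%:E <= zeta lambda n (holder_class alpha))%E.
  move=> n0; apply: le_ereal_inf_tmp => _ [p [x [y [_ _ ->]]]].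
  exact: error_node_bump.
have zeta_le n : (0 < n)%N -> (zeta lambda n (holder_class alpha) <=
    error lambda (cell_weight lambda (n := n)) (@midpoint R n) (@midpoint R n)
      (holder_class alpha))%E.
  move=> n0; apply: ereal_inf_lbound.
  exists (cell_weight lambda (n := n)), (@midpoint R n), (@midpoint R n).
  by split => // k; exact: midpoint_itv.
have IE : (\int[(@lebesgue_measure R \x @lebesgue_measure R)%E]_(z in square)
    (riesz lambda (0%R, 0%R) z)%:E = (I lambda)%:E)%E.
  rewrite /I /Rintegral fineK//; apply: integrable_fin_num.
    exact: measurable_square.
  exact: (integrable_riesz lambda _ hlambda square_center).
split.
- exists 1, (4 * I lambda / ((1 + alpha) * L)); split => //.
    by rewrite divr_gt0 ?mulr_gt0//; lra.
  near=> n.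
  have n0 : (0 < n)%N by near: n; exact: nbhs_infty_gt.
  have n0R : 0 < n%:R :> R by rewrite ltr0n.
  have eps1 : eps n <= 1.
    rewrite -[eps n]ger0_norm// -[X in `|X|]subr0 distrC.
    by near: n; move/cvgrPdist_le : cvg_eps => /(_ 1 ltr01).
  split.
  + apply/andP; split.
      by apply: lt_le_trans (zeta_ge _ n0); rewrite lte_fin divr_gt0 ?powR_gt0.
    by rewrite (le_lt_trans (zeta_le _ n0))// (le_lt_trans (error_le _ n0))// ltry.
  + by rewrite mul1e; exact: zeta_le.
  + rewrite (le_trans (error_le _ n0))//.
    apply: (@le_trans _ _ ((4 * I lambda / ((1 + alpha) * L))%:E * (L / n%:R `^ alpha)%:E)%E).
      rewrite -EFinM lee_fin.
      have -> : 4 * I lambda / ((1 + alpha) * L) * (L / n%:R `^ alpha) =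
          2 * A0 n * I lambda.
        rewrite /A0; field; rewrite !gt_eqF ?powR_gt0//; lra.
      rewrite ler_wpM2r ?(ltW I0)// ler_wpM2r//; last by lra.
      by rewrite /A0 divr_ge0// mulr_ge0 ?powR_ge0//; lra.
    rewrite lee_pmul2l//; first exact: zeta_ge.
    by rewrite lte_fin divr_gt0 ?mulr_gt0//; lra.
exists eps; split => //; near=> n.
have n0 : (0 < n)%N by near: n; exact: nbhs_infty_gt.
set A := (1 + eps n) * _; set S := ereal_sup _; set J := (X in (_ /\ (_ <= _ * X)%E)).
have JE : J = (I lambda)%:E.
  rewrite -IE /J /lebesgue2; apply: eq_integral => z _.
  by rewrite /riesz/= !subr0.
have SE : S = (I lambda)%:E.
  apply/eqP; rewrite eq_le; apply/andP; split.
    apply: ge_ereal_sup => _ [t St ->]; rewrite -IE.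
    exact: integral_riesz_center.
  by apply: ereal_sup_ubound; exists (0, 0); [exact: square_center|rewrite -IE].
by rewrite JE SE -EFinM; split => //; exact: error_le.
Unshelve. all: end_near. Qed.
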